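(* Let $P$ be a puzzle of size $n$ and let $f_P:\mathrm{HONEY}_n\to\mathbb{R}$ be the functional $$f_P(h)=\sum_{R\text{ a rhombus of }P}\text{(length of the edge of $h$ corresponding to $R$)}.$$ Then for every $h\in\mathrm{HONEY}_n$, $$f_P(h)=\sum_{e\text{ a boundary edge of $P$ labeled }0}\text{(constant coordinate on the boundary edge of $h$ corresponding to $e$)}.$$ In particular $f_P$ descends to a nonnegative functional on $\mathrm{BDRY}(n)$; that is, the inequality $f_P\ge0$ is satisfied by $\mathrm{BDRY}(n)$.
   Context: Puzzles. Work in the triangular lattice in the plane with one family of lattice lines horizontal. A puzzle piece is one of: (i) a unit lattice triangle with all edges labeled $0$; (ii) a unit lattice triangle with all edges labeled $1$; (iii) a unit rhombus (two unit lattice triangles joined along an edge, in any of the three lattice orientations) labeled so that, traversing its boundary clockwise, an edge is labeled $1$ if it immediately follows an obtuse ($120^\circ$) vertex and $0$ if it immediately follows an acute ($60^\circ$) vertex. A puzzle of size $n$ is a decomposition of the upward-pointing lattice triangle $\Delta_n$ of side-length $n$ (sides called NW, NE, S) into lattice polygons, all edges labeled $0$ or $1$, such that each region is a puzzle piece (so neighboring pieces agree on the label of a common edge). Honeycombs. In the plane $\{(x,y,z)\in\mathbb{R}^3:x+y+z=0\}$ use the directions $NW=(0,1,-1)$, $NE=(-1,0,1)$, $S=(1,-1,0)$ (and $SE,SW,N$ their respective negatives); these are drawn as the outward normals of the corresponding sides of $\Delta_n$. A honeycomb $h\in\mathrm{HONEY}_n$ is an assignment of a point $h(t)$ of this plane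 (a vertex of $h$) to each unit lattice triangle $t$ of $\Delta_n$ such that, whenever an upward unit triangle $u$ and a downward unit triangle $d$ share an edge $e$, one has $h(d)=h(u)+\ell_e D$ with $\ell_e\ge0$, where $D\in\{NW,NE,S\}$ is the direction normal to $e$ pointing from $u$ to $d$. The segment from $h(u)$ to $h(d)$ is the (bounded) edge of $h$ corresponding to the unit rhombus $u\cup d$, and $\ell_e$ is its length. To each boundary edge of $\Delta_n$ on the side $D\in\{NW,NE,S\}$, belonging to the upward triangle $u$, corresponds the boundary (semi-infinite) edge of $h$, the ray from $h(u)$ in direction $D$; its constant coordinate is the first coordinate if $D=NW$, the second if $D=NE$, the third if $D=S$. The boundary $\partial h=(\lambda,\mu,\nu)\in(\mathbb{R}^n)^3$ consists of the constant coordinates on the NW, NE, S sides respectively, each read clockwise around $\Delta_n$ (these are weakly decreasing lists). $\mathrm{BDRY}(n)=\partial(\mathrm{HONEY}_n)$; it equals the set of triples of weakly decreasing spectra of $n\times n$ Hermitian matrices with zero sum. *)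

(* Defs.v *)
From HB Require Import structures.
From mathcomp Require Import all_boot all_order all_algebra.
From mathcomp Require Import classical_sets reals.

Set Implicit Arguments.
Unset Strict Implicit.
Unset Printing Implicit Defensive.

Import GRing.Theory.
Local Open Scope ring_scope.

Inductive side := NW | NE | S.

Definition ord_of_side (D : side) : 'I_3 :=
  match D with NW => inord 0 | NE => inord 1 | S => inord 2 end.
Definition side_of_ord (i : 'I_3) : side :=
  match val i with 0 => NW | 1 => NE | _ => S end%N.
Lemma ord_of_sideK : cancel ord_of_side side_of_ord.
Proof. by case; rewrite /side_of_ord /= inordK. Qed.
HB.instance Definition _ := Finite.copy side (can_type ord_of_sideK).

(* The pair (i, j) is the lattice point i * a + j * b, where a is the unit
   vector pointing east and b is a rotated counterclockwise by 60 degrees.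
   The vertices of Delta_n are (0, 0), (n, 0) and (0, n). *)
Definition lpoint := (nat * nat)%type.

(* The upward unit triangles of Delta_n (by their lower left corner (i, j))
   and the downward ones (corners (i+1, j), (i, j+1) and (i+1, j+1)). *)
Definition up (n : nat) := {x : 'I_n * 'I_n | (x.1 + x.2 < n)%N}.
Definition dn (n : nat) := {x : 'I_n * 'I_n | ((x.1 + x.2).+1 < n)%N}.
HB.instance Definition _ n := Finite.on (up n).
HB.instance Definition _ n := Finite.on (dn n).
Definition tri (n : nat) := (up n + dn n)%type.
HB.instance Definition _ n := Finite.on (tri n).

(* Listed clockwise. *)
Definition corners n (t : tri n) : seq lpoint :=
  match t with
  | inl u => let: (i, j) := val u in
      [:: (i : nat, j : nat); (i : nat, j.+1); (i.+1, j : nat)]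
  | inr d => let: (i, j) := val d in
      [:: (i.+1, j : nat); (i : nat, j.+1); (i.+1, j.+1)]
  end.

(* The three edges of t, each directed so that they traverse t clockwise. *)
Definition edges n (t : tri n) : seq (lpoint * lpoint) :=
  zip (corners t) (rot 1 (corners t)).

(* The edge on side D of an upward triangle, directed clockwise. *)
Definition up_edge n (u : up n) (D : side) : lpoint * lpoint :=
  let: (i, j) := val u in
  match D with
  | NW => ((i : nat, j : nat), (i : nat, j.+1))
  | NE => ((i : nat, j.+1), (i.+1, j : nat))
  | S => ((i.+1, j : nat), (i : nat, j : nat))
  end.

(* u and d share the edge on side D of u; the clockwise traversals of two
   neighbouring triangles run through their common edge in opposite ways. *)
Definition share n (u : up n) (d : dn n) (D : side) : bool :=
  ((up_edge u D).2, (up_edge u D).1) \in edges (inr d : tri n).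

(* e is an edge of the polygon A directed so as to traverse A clockwise. *)
Definition on_boundary n (A : {set tri n}) (e : lpoint * lpoint) : bool :=
  [exists t in A, e \in edges t] && ~~ [exists t in A, (e.2, e.1) \in edges t].

(* The angle, in degrees, of the polygon A at its vertex p. *)
Definition angle n (A : {set tri n}) (p : lpoint) : nat :=
  (60 * #|[set t in A | p \in corners t]|)%N.

Definition rhombus n (A : {set tri n}) : bool :=
  [exists u : up n, exists d : dn n, exists D : side,
     (A == [set inl u; inr d]) && share u d D].

(* Labels are booleans: true is the label 1 and false is the label 0. *)
Definition triangle_piece n (lab : lpoint -> lpoint -> bool) (A : {set tri n}) :=
  exists (t : tri n) (b : bool),
    A = [set t] /\ forall e, on_boundary A e -> lab e.1 e.2 = b.

(* In a clockwise traversal the edge e follows the vertex e.1. *)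
Definition rhombus_piece n (lab : lpoint -> lpoint -> bool) (A : {set tri n}) :=
  rhombus A /\
  forall e, on_boundary A e ->
    (angle A e.1 = 120%N -> lab e.1 e.2 = true) /\
    (angle A e.1 = 60%N -> lab e.1 e.2 = false).

(* A region is given by the set of unit triangles it contains.  The values of
   [label] only matter on the edges of the regions. *)
Record puzzle (n : nat) := Puzzle {
  regions : {set {set tri n}};
  label : lpoint -> lpoint -> bool;
  label_sym : forall p q, label p q = label q p;
  regions_partition : finset.partition regions [set: tri n]%SET;
  regions_pieces : forall A, A \in regions ->
    triangle_piece label A \/ rhombus_piece label A
}.

Section Honeycombs.
Variable R : realType.

Definition vec3 (x y z : R) : 'rV[R]_3 := \row_(i < 3) [:: x; y; z]`_i.

(* The outward normal of side D of Delta_n. *)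
Definition dirv (D : side) : 'rV[R]_3 :=
  match D with
  | NW => vec3 0 1 (-1)
  | NE => vec3 (-1) 0 1
  | S => vec3 1 (-1) 0
  end.

Definition honeycomb n (h : tri n -> 'rV[R]_3) : Prop :=
  (forall t, \sum_(i < 3) h t 0 i = 0) /\
  (forall (u : up n) (d : dn n) (D : side), share u d D ->
     exists2 l : R, 0 <= l & h (inr d) = h (inl u) + l *: dirv D).

Definition HONEY (n : nat) : set (tri n -> 'rV[R]_3) := @honeycomb n.

Definition is_edge_length n (h : tri n -> 'rV[R]_3) (A : {set tri n}) (l : R) :=
  exists (u : up n) (d : dn n) (D : side),
    [/\ A = [set inl u; inr d], share u d D &
        h (inr d) = h (inl u) + l *: dirv D].

(* For a rhombus A and h in HONEY n exactly one l satisfies is_edge_length. *)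
Definition edge_length n (h : tri n -> 'rV[R]_3) (A : {set tri n}) : R :=
  xget 0 (is_edge_length h A).

Definition puzzle_functional n (P : puzzle n) (h : tri n -> 'rV[R]_3) : R :=
  \sum_(A in regions P | rhombus A) edge_length h A.

Definition ord_zero n (k : 'I_n) : 'I_n :=
  Ordinal (leq_ltn_trans (leq0n k) (ltn_ord k)).

Lemma bd_NW_subproof n (k : 'I_n) : (ord_zero k + k < n)%N.
Proof. exact: ltn_ord. Qed.
Lemma bd_NE_subproof n (k : 'I_n) : (k + rev_ord k < n)%N.
Proof. by rewrite /= -addSn subnKC. Qed.
Lemma bd_S_subproof n (k : 'I_n) : (rev_ord k + ord_zero k < n)%N.
Proof. by rewrite addn0. Qed.

(* The upward triangle containing the k-th boundary edge on side D of Delta_n,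
   where the edges on D are numbered clockwise around Delta_n. *)
Definition bd_up n (D : side) (k : 'I_n) : up n :=
  match D with
  | NW => exist _ (ord_zero k, k) (bd_NW_subproof k)
  | NE => exist _ (k, rev_ord k) (bd_NE_subproof k)
  | S => exist _ (rev_ord k, ord_zero k) (bd_S_subproof k)
  end.

(* The coordinate that is constant along the direction [dirv D]. *)
Definition constant_index (D : side) : 'I_3 :=
  match D with NW => inord 0 | NE => inord 1 | S => inord 2 end.

Definition constant_coord n (h : tri n -> 'rV[R]_3) (D : side) (k : 'I_n) : R :=
  h (inl (bd_up D k)) 0 (constant_index D).

Definition triple (n : nat) := ('rV[R]_n * 'rV[R]_n * 'rV[R]_n)%type.

Definition bdry n (h : tri n -> 'rV[R]_3) : triple n :=
  (\row_k constant_coord h NW k, \row_k constant_coord h NE k,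
   \row_k constant_coord h S k).

Definition BDRY (n : nat) : set (triple n) := (@bdry n @` @HONEY n)%classic.

End Honeycombs.

Arguments HONEY : clear implicits.
Arguments BDRY : clear implicits.

Definition bd_label n (P : puzzle n) (D : side) (k : 'I_n) : bool :=
  let e := up_edge (bd_up D k) D in label P e.1 e.2.

(* Main.v *)
Require Import Defs.
From HB Require Import structures.
From mathcomp Require Import all_boot all_order all_algebra.
From mathcomp Require Import classical_sets reals.
From mathcomp Require Import zify ring.

Set Implicit Arguments.
Unset Strict Implicit.
Unset Printing Implicit Defensive.

Import GRing.Theory Num.Theory.

Local Open Scope ring_scope.

(** Give every unit triangle [t] of the lattice its flux: the sum, over the
    sides [D] of [t] labeled 0, of the coordinate of [h t] that is constant in
    the direction [dirv D], counted with sign + if [t] points upwards and - if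
    it points downwards.  The theorem comes from computing the total flux in
    two ways.

    Edge by edge ([sum_flux]): if an upward and a downward triangle share the
    edge on side [D], their points differ by a multiple of [dirv D], so they
    have the same [D]-coordinate, and the two contributions of the edge cancel.
    Only the edges on the boundary of the big triangle remain; they give the
    sum of the constant coordinates at the labels 0.

    Region by region ([puzzle_functionalE]): a triangle labeled 1 contributes
    nothing, and a triangle labeled 0 contributes the sum of the coordinates of
    a point of the plane x + y + z = 0 ([flux_triangle]).  In a rhombus whose
    halves share side [D], the sides labeled 0 are the two parallel ones on side
    [ccw D], the side that precedes [D] clockwise; they contribute the difference
    of the [ccw D]-coordinates of [h u] and [h d].  Since [dirv D] has entry -1
    there, this difference is the length of the corresponding edge of [h]
    ([flux_rhombus]).

    The boundary expression is visibly linear in the boundary of [h], and the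
    sum of lengths is nonnegative, which gives the last part. *)

(** * The three sides and their coordinates *)

Lemma sum_side (V : nmodType) (f : side -> V) :
  \sum_(D : side) f D = f NW + f NE + f S.
Proof.
rewrite (bigD1 NW) // (bigD1 NE); last by apply/eqP.
rewrite (bigD1 S) /=; last by apply/andP; split; apply/eqP.
by rewrite big1 ?addr0 ?addrA // => -[]; rewrite eqxx ?andbF.
Qed.

Definition cw (D : side) : side :=
  match D with NW => NE | NE => S | S => NW end.
Definition ccw (D : side) : side :=
  match D with NW => S | NE => NW | S => NE end.

Lemma sum_side_around (V : nmodType) (f : side -> V) (D : side) :
  \sum_(E : side) f E = f D + f (cw D) + f (ccw D).
Proof.
rewrite sum_side; case: D => //=.
  by rewrite -addrA addrC.
by rewrite addrC addrA.
Qed.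

(** This is why a shared edge has one constant coordinate, whichever of its
    two triangles it is read from. *)
Lemma dirv_constant_index (R : realType) D :
  dirv R D 0 (constant_index D) = 0.
Proof. by case: D; rewrite !mxE /= inordK. Qed.

(** The coordinate through which the length of an edge of a honeycomb is read
    off from its endpoints. *)
Lemma dirv_constant_index_ccw (R : realType) D :
  dirv R D 0 (constant_index (ccw D)) = -1.
Proof. by case: D; rewrite !mxE /= inordK. Qed.

Lemma sum_constant_index (R : realType) (v : 'rV[R]_3) :
  \sum_(D : side) v 0 (constant_index D) = \sum_(i < 3) v 0 i.
Proof.
rewrite sum_side !big_ord_recr big_ord0 /= add0r.
by congr (v _ _ + v _ _ + v _ _); apply/val_inj; rewrite /= inordK.
Qed.

(** * Unit triangles and their common edges *)

Section Triangles.
Variable n : nat.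

Definition mkup (i j : nat) (lt_n : (i + j < n)%N) : up n :=
  exist _ (Ordinal (leq_ltn_trans (leq_addr j i) lt_n),
           Ordinal (leq_ltn_trans (leq_addl i j) lt_n)) lt_n.

Lemma lt_across_NW (d : dn n) : ((val d).1.+1 + (val d).2 < n)%N.
Proof. exact: (valP d). Qed.
Lemma lt_across_NE (d : dn n) : ((val d).1 + (val d).2 < n)%N.
Proof. exact: ltnW (valP d). Qed.
Lemma lt_across_S (d : dn n) : ((val d).1 + (val d).2.+1 < n)%N.
Proof. by rewrite addnS; exact: (valP d). Qed.

(** The upward triangle whose side [D] is an edge of [d]: it always lies in
    the big triangle, whereas an upward triangle on the boundary has no downward
    neighbour there; hence the choice of [d] as the argument. *)
Definition across (D : side) (d : dn n) : up n :=
  match D with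
  | NW => mkup (lt_across_NW d)
  | NE => mkup (lt_across_NE d)
  | S => mkup (lt_across_S d)
  end.

Lemma up_inj (u v : up n) : (val u).1 = (val v).1 :> nat ->
  (val u).2 = (val v).2 :> nat -> u = v.
Proof.
by move=> e1 e2; apply/val_inj; case: (val u) (val v) e1 e2 => [i j] [k l] /=;
  move=> /val_inj-> /val_inj->.
Qed.

Lemma dn_inj (u v : dn n) : (val u).1 = (val v).1 :> nat ->
  (val u).2 = (val v).2 :> nat -> u = v.
Proof.
by move=> e1 e2; apply/val_inj; case: (val u) (val v) e1 e2 => [i j] [k l] /=;
  move=> /val_inj-> /val_inj->.
Qed.

Lemma share_across (u : up n) (d : dn n) (D : side) :
  share u d D = (u == across D d).
Proof.
apply/idP/eqP => [|->].
  case: u d D => [[[i Hi] [j Hj]] Hij] [[[k Hk] [l Hl]] Hkl] D.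
  by case: D; rewrite /share /edges /= !inE !xpair_eqE => H;
    apply: up_inj => /=; lia.
case: d => [[[k Hk] [l Hl]] Hkl].
by case: D; rewrite /share /up_edge /edges /= !inE !xpair_eqE /=; lia.
Qed.

(** An edge on side [D] of an upward triangle either lies on the boundary or is
    shared with a unique downward triangle; the sum type enumerates these edges,
    and sends each to its upward triangle. *)
Definition up_of_edge (D : side) (x : 'I_n + dn n) : up n :=
  match x with inl k => bd_up D k | inr d => across D d end.

Lemma up_of_edge_inj (D : side) : injective (up_of_edge D).
Proof.
move=> [k|d] [l|e] E; have := congr1 (fun u : up n => ((val u).1 : nat)) E;
have := congr1 (fun u : up n => ((val u).2 : nat)) E; clear E; rewrite /=.
- have := ltn_ord k; have := ltn_ord l.
  by case: D => /= *; congr inl; apply: val_inj => /=; lia.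
- by have := valP e; case: D => /=; lia.
- by have := valP d; case: D => /=; lia.
- by case: D => /= *; congr inr; apply: dn_inj => /=; lia.
Qed.

Definition mkdn (i j : nat) (lt_n : ((i + j).+1 < n)%N) : dn n :=
  exist _ (Ordinal (leq_ltn_trans (leq_addr j i) (ltnW lt_n)),
           Ordinal (leq_ltn_trans (leq_addl i j) (ltnW lt_n))) lt_n.

Lemma up_of_edge_surj (D : side) (u : up n) :
  exists x, up_of_edge D x == u.
Proof.
case: u => [[[i Hi] [j Hj]] Hij]; move: (Hij) => /= H; case: D.
- case: i Hi Hij H => [|i] Hi Hij H.
    by exists (inl (Ordinal Hj)); apply/eqP/up_inj.
  by exists (inr (mkdn H)); apply/eqP/up_inj.
- case: (ltnP (i + j).+1 n) => H'.
    by exists (inr (mkdn H')); apply/eqP/up_inj.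
  by exists (inl (Ordinal Hi)); apply/eqP/up_inj => //=; lia.
- case: j Hj Hij H => [|j] Hj Hij H.
    by exists (inl (rev_ord (Ordinal Hi))); apply/eqP/up_inj => //=; lia.
  have H' : ((i + j).+1 < n)%N by rewrite -addnS.
  by exists (inr (mkdn H')); apply/eqP/up_inj.
Qed.

(** The bijection between upward triangles and edges in the direction of [D],
    in the form of a summation rule. *)
Lemma sum_up (V : nmodType) (D : side) (F : up n -> V) :
  \sum_u F u = \sum_(k < n) F (bd_up D k) + \sum_d F (across D d).
Proof.
rewrite (reindex (up_of_edge D)) ?big_sumType //=.
exists (fun u => xchoose (up_of_edge_surj D u)) => [x _|u _].
  exact/up_of_edge_inj/eqP/(xchooseP (up_of_edge_surj D _)).
exact/eqP/(xchooseP (up_of_edge_surj D u)).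
Qed.

(** A downward triangle traverses a shared edge against the direction in which
    its upward neighbour does. *)
Definition side_edge (t : tri n) (D : side) : lpoint * lpoint :=
  match t with
  | inl u => up_edge u D
  | inr d => let e := up_edge (across D d) D in (e.2, e.1)
  end.

(** * Boundaries and angles of the pieces *)

Lemma on_boundary_triangle (t : tri n) D :
  on_boundary [set t] (side_edge t D).
Proof.
apply/andP; split; first apply/existsP; last apply/existsPn.
  exists t; rewrite inE eqxx /=.
  case: t => [[[[i Hi] [j Hj]] Hij]|[[[i Hi] [j Hj]] Hij]]; case: D;
  by rewrite /edges /= !inE !xpair_eqE /=; lia.
move=> t'; rewrite inE; case: eqP => // -> /=.
case: t => [[[[i Hi] [j Hj]] Hij]|[[[i Hi] [j Hj]] Hij]]; case: D;
by rewrite /edges /= !inE !xpair_eqE /=; lia.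
Qed.

(** Only the edge on side [D], common to both halves, is interior. *)
Lemma on_boundary_rhombus (D E : side) (d : dn n) (t : tri n) :
  let A := [set inl (across D d); inr d] in
  E <> D -> t \in A -> on_boundary A (side_edge t E).
Proof.
move=> A neq tA.
apply/andP; split; first apply/existsP; last apply/existsPn.
  exists t; rewrite tA /=; case/andP: (on_boundary_triangle t E) => + _.
  by case/existsP => t'; rewrite inE => /andP[/eqP->].
move=> t'; move: tA; rewrite !inE.
case: d @A => [[[i Hi] [j Hj]] Hij] A.
by case/orP=> /eqP->; case: (boolP (t' == _)) => [/eqP->|_] /=;
  try (case: (boolP (t' == _)) => [/eqP->|_] /=);
  case: D E neq {A} => [] [] //= _; rewrite /edges /= ?inE ?xpair_eqE //=; lia.
Qed.

Lemma angle2 (t t' : tri n) p : t != t' ->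
  angle [set t; t'] p = (60 * ((p \in corners t) + (p \in corners t')))%N.
Proof.
move=> neq; congr muln.
rewrite -sum1_card (eq_bigl (fun x => (x \in [set t; t']) && (p \in corners x))).
  by rewrite big_mkcondr big_setU1 ?inE //= big_set1; do 2!case: (_ \in _).
by move=> x; rewrite !inE.
Qed.

(** The obtuse vertices of the rhombus are the ends of the edge on side [D]
    shared by its halves.  In each half, clockwise, the next edge after it
    starts at one of these ends. *)
Lemma rhombus_angle_cw (D : side) (d : dn n) (t : tri n) :
  let A := [set inl (across D d); inr d] in
  t \in A -> angle A (side_edge t (cw D)).1 = 120%N.
Proof.
move=> A; rewrite /A !inE angle2 // => tA.
suff [-> ->] : (side_edge t (cw D)).1 \in corners (inl (across D d) : tri n) /\
   (side_edge t (cw D)).1 \in corners (inr d : tri n) by [].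
case: d @A tA => [[[i Hi] [j Hj]] Hij] A.
by case/orP => /eqP->; case: D {A}; rewrite /= !inE !xpair_eqE /=; split; lia.
Qed.

(** The edge that precedes the shared one starts at the vertex opposite to it,
    which belongs to one half only. *)
Lemma rhombus_angle_ccw (D : side) (d : dn n) (t : tri n) :
  let A := [set inl (across D d); inr d] in
  t \in A -> angle A (side_edge t (ccw D)).1 = 60%N.
Proof.
move=> A; rewrite /A !inE angle2 // => tA.
suff -> : ((side_edge t (ccw D)).1 \in corners (inl (across D d) : tri n)) =
   ((side_edge t (ccw D)).1 \notin corners (inr d : tri n)) by case: (_ \in _).
case: d @A tA => [[[i Hi] [j Hj]] Hij] A.
by case/orP => /eqP->; case: D {A}; rewrite /= !inE !xpair_eqE /=; lia.
Qed.

End Triangles.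

(** * The flux of a honeycomb through a labeled tiling *)

Section Flux.
Variables (R : realType) (n : nat) (lab : lpoint -> lpoint -> bool).
Variable h : tri n -> 'rV[R]_3.
Hypothesis lab_sym : forall p q, lab p q = lab q p.
Hypothesis honey_h : HONEY R n h.

Definition zero_coord (t : tri n) (D : side) : R :=
  let e := side_edge t D in
  if lab e.1 e.2 then 0 else h t 0 (constant_index D).

Definition flux (t : tri n) : R :=
  match t with
  | inl _ => \sum_D zero_coord t D
  | inr _ => - \sum_D zero_coord t D
  end.

(** Moving along [dirv D] leaves the [D]-coordinate unchanged, so an interior
    edge is weighted equally by its two triangles, whatever its label. *)
Lemma zero_coord_across (d : dn n) (D : side) :
  zero_coord (inl (across D d)) D = zero_coord (inr d) D.
Proof.
have := share_across (across D d) d D; rewrite eqxx => sh.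
have [l _ hd] := honey_h.2 _ _ _ sh.
by rewrite /zero_coord /= lab_sym hd !mxE dirv_constant_index mulr0 addr0.
Qed.

(** The interior edges cancel by [zero_coord_across]. *)
Lemma sum_flux :
  \sum_t flux t = \sum_D \sum_(k < n) zero_coord (inl (bd_up D k)) D.
Proof.
rewrite big_sumType /= sumrN exchange_big /= [X in _ - X]exchange_big /= -sumrB.
apply: eq_bigr => D _; rewrite (sum_up D).
rewrite [X in _ + X - _](eq_bigr _ (fun d _ => zero_coord_across d D)).
by rewrite addrK.
Qed.

(** With all labels 0 the three coordinates of [h t] are added, and they sum
    to zero; with all labels 1 the sum is empty. *)
Lemma flux_triangle (A : {set tri n}) :
  triangle_piece lab A -> \sum_(t in A) flux t = 0.
Proof.
case=> t [b [-> labA]]; rewrite big_set1.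
suff: \sum_D zero_coord t D = 0 by case: t {labA} => ? /= ->; rewrite ?oppr0.
case: b labA => labA.
  by rewrite big1 // => D _; rewrite /zero_coord labA ?on_boundary_triangle.
under eq_bigr => D _ do rewrite /zero_coord labA ?on_boundary_triangle //.
by rewrite sum_constant_index honey_h.1.
Qed.

(** The shared edge cancels, the sides [cw D] are labeled 1 and the sides
    [ccw D] are labeled 0; so the flux is the [ccw D]-coordinate of
    [h u - h d = - l *: dirv D], which is [l]. *)
Lemma flux_rhombus (A : {set tri n}) (l : R) :
  rhombus_piece lab A -> is_edge_length h A l -> \sum_(t in A) flux t = l.
Proof.
move=> [_ labA] [u [d [D [defA shD hd]]]].
move: shD defA hd; rewrite share_across => /eqP-> defA hd.
rewrite defA in labA *.
have zc_cw t : t \in [set inl (across D d); inr d] -> zero_coord t (cw D) = 0.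
  move=> tA; rewrite /zero_coord (labA _ _).1 //.
    by apply: on_boundary_rhombus => //; case: (D).
  exact: rhombus_angle_cw.
have zc_ccw t : t \in [set inl (across D d); inr d] ->
    zero_coord t (ccw D) = h t 0 (constant_index (ccw D)).
  move=> tA; rewrite /zero_coord (labA _ _).2 //.
    by apply: on_boundary_rhombus => //; case: (D).
  exact: rhombus_angle_ccw.
rewrite big_setU1 ?inE //= big_set1 /= !(sum_side_around _ D).
rewrite zero_coord_across !zc_cw ?zc_ccw ?inE ?eqxx ?orbT // hd !mxE.
rewrite dirv_constant_index_ccw; ring.
Qed.

Lemma edge_length_spec (A : {set tri n}) :
  rhombus A -> is_edge_length h A (edge_length h A).
Proof.
case/existsP=> u /existsP[d /existsP[D]] /andP[/eqP defA sh].
have [l _ hd] := honey_h.2 _ _ _ sh.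
by apply: (@xgetPex _ 0 (is_edge_length h A)); exists l, u, d, D.
Qed.

Lemma edge_length_ge0 (A : {set tri n}) : rhombus A -> 0 <= edge_length h A.
Proof.
move=> /edge_length_spec[u [d [D [_ sh]]]].
have [l l_ge0 ->] := honey_h.2 _ _ _ sh.
(* Both lengths are minus the increment of the coordinate on side [ccw D]. *)
move=> /addrI/rowP/(_ (constant_index (ccw D))).
rewrite ![in X in X -> _]mxE.
by rewrite !dirv_constant_index_ccw !mulrN1 => /oppr_inj<-.
Qed.

End Flux.

(** * The functional of a puzzle *)

Lemma triangle_piece_not_rhombus n lab (A : {set tri n}) :
  triangle_piece lab A -> rhombus A = false.
Proof.
case=> t [b [-> _]]; apply/negbTE/negP; case/existsP=> u /existsP[d /existsP[D]].
by case/andP=> /eqP/(congr1 (fun A : {set _} => #|A|)); rewrite cards1 cards2.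
Qed.

(** The regions partition the unit triangles, so the total flux may be summed
    region by region; only the rhombi contribute. *)
Lemma puzzle_functionalE (R : realType) n (P : puzzle n) h : HONEY R n h ->
  puzzle_functional P h = \sum_t flux (label P) h t.
Proof.
move=> hh; rewrite -(eq_bigl _ _ (@finset.in_setT (tri n))).
rewrite (set_partition_big _ (regions_partition P)) /=.
rewrite /puzzle_functional big_mkcondr.
apply: eq_bigr => A /regions_pieces[tA|rA].
  by rewrite (triangle_piece_not_rhombus tA) (flux_triangle hh).
have lenA := edge_length_spec hh rA.1.
by rewrite rA.1 (flux_rhombus (@label_sym _ P) hh rA lenA).
Qed.

Definition bdry_side (R : realType) n (b : triple R n) (D : side) : 'rV[R]_n :=
  match D with NW => b.1.1 | NE => b.1.2 | S => b.2 end.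

Definition bdry_functional (R : realType) n (P : puzzle n) (b : triple R n) : R :=
  \sum_(D : side) \sum_(k < n | bd_label P D k == false) bdry_side b D 0 k.

Lemma bdry_functional_is_linear (R : realType) n (P : puzzle n) :
  scalar (bdry_functional (R := R) P).
Proof.
move=> a b c; rewrite /bdry_functional mulr_sumr -big_split /=.
apply: eq_bigr => D _; rewrite mulr_sumr -big_split /=.
by apply: eq_bigr => k _; case: D; rewrite !mxE.
Qed.

HB.instance Definition _ (R : realType) n (P : puzzle n) :=
  GRing.isLinear.Build R (triple R n) R *%R (bdry_functional P)
    (bdry_functional_is_linear P).

Theorem theorem2 (R : realType) (n : nat) (P : puzzle n) :
  (forall h : tri n -> 'rV[R]_3, HONEY R n h ->
     puzzle_functional P h =
     \sum_(D : side) \sum_(k < n | bd_label P D k == false)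
       constant_coord h D k) /\
  (exists phi : {scalar triple R n},
     (forall h : tri n -> 'rV[R]_3, HONEY R n h ->
        puzzle_functional P h = phi (bdry h)) /\
     (forall b : triple R n, BDRY R n b -> 0 <= phi b)).
Proof.
have fE h : HONEY R n h -> puzzle_functional P h =
    \sum_(D : side) \sum_(k < n | bd_label P D k == false) constant_coord h D k.
  move=> hh; rewrite puzzle_functionalE // (sum_flux (@label_sym _ P) hh).
  apply: eq_bigr => D _; rewrite [RHS]big_mkcond /=; apply: eq_bigr => k _.
  by rewrite /zero_coord /constant_coord /bd_label /=; case: (label P _ _).
have phiE h : HONEY R n h -> puzzle_functional P h = bdry_functional P (bdry h).
  move=> /fE->; rewrite /bdry_functional; apply: eq_bigr => D _.
  apply: eq_bigr => k _.
  by case: D; rewrite mxE.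
split=> //; exists (bdry_functional P); split=> // _ [h hh <-].
have: 0 <= puzzle_functional P h.
  by rewrite sumr_ge0 // => A /andP[_]; apply: edge_length_ge0.
by rewrite (phiE h hh).
Qed.
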